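(* Let $G$ be a graph and let $u$ and $v$ be two distinct vertices of $G$. Then (a) $\gamma(G)-1 \leq \gamma(G_{u,v,k})$ for all integers $k \geq 1$, and (b) $\gamma(G_{u,v,k}) > \gamma(G)$ for all integers $k \geq 5$.
   Context: Graphs are finite and simple. $\gamma(H)$ denotes the domination number of a graph $H$, i.e. the smallest cardinality of a dominating set. For distinct vertices $u,v$ of $G$ (adjacent or not) and an integer $k \geq 1$, $G_{u,v,k}$ denotes the graph obtained from the disjoint union of $G$ and a path $x_0,x_1,\dots,x_{k+1}$ by identifying $u$ with $x_0$ and $v$ with $x_{k+1}$ (so $k$ new vertices $x_1,\dots,x_k$ are added; if $uv$ is an edge of $G$ it is kept). *)

(* Defs.v *)
From HB Require Import structures.
From mathcomp Require Import all_boot.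

Set Implicit Arguments.
Unset Strict Implicit.
Unset Printing Implicit Defensive.

Record sgraph := SGraph {
  svertex :> finType;
  sedge : rel svertex;
  sedge_sym : symmetric sedge;
  sedge_irr : irreflexive sedge }.

Definition dominating (G : sgraph) (D : {set G}) : bool :=
  [forall x, (x \in D) || [exists y in D, sedge x y]].

(* [set: G] is always dominating, so the minimum below is a genuine one. *)
Definition domination_number (G : sgraph) : nat :=
  #|[arg min_(D < [set: G] | dominating D) #|D|]|.

(* Vertices of G_{u,v,k}: those of G together with k new ones, where inr i
   stands for x_(i+1).  The vertex x_i of the path, after identification of
   x_0 with u and of x_(k+1) with v, is path_vertex i, for 0 <= i <= k+1. *)
Definition path_vertex (G : sgraph) (u v : G) (k : nat) (i : nat) : G + 'I_k :=
  if i is i'.+1 then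
    if insub i' is Some j then inr j else inl v
  else inl u.

Definition add_path_edge (G : sgraph) (u v : G) (k : nat) : rel (G + 'I_k) :=
  fun p q =>
  [|| if (p, q) is (inl a, inl b) then sedge a b else false,
      [exists i : 'I_k.+1,
         (p == path_vertex u v k i) && (q == path_vertex u v k i.+1)]
    | [exists i : 'I_k.+1,
         (q == path_vertex u v k i) && (p == path_vertex u v k i.+1)]].

Arguments add_path_edge {G} u v k p q : rename.

Lemma add_path_edge_sym (G : sgraph) (u v : G) (k : nat) :
  symmetric (add_path_edge u v k).
Proof.
move=> p q; rewrite /add_path_edge; congr (_ || _); last exact: orbC.
by case: p q => [a|i] [b|j] //; apply: sedge_sym.
Qed.

Lemma path_vertex_neqS (G : sgraph) (u v : G) (k : nat) (neq_uv : u != v) (i : nat) :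
  i < k.+1 -> path_vertex u v k i != path_vertex u v k i.+1.
Proof.
case: i => [|i] ik /=.
  by case: insubP => [j _ _|_] //; apply: contra neq_uv => /eqP[->].
rewrite insubT /=; case: insubP => [j _ jE|_] //.
by apply/eqP => -[] /(congr1 val) /=; move: jE => /= -> /n_Sn.
Qed.

Lemma add_path_edge_irr (G : sgraph) (u v : G) (k : nat) (neq_uv : u != v) :
  irreflexive (add_path_edge u v k).
Proof.
move=> p; rewrite /add_path_edge orbb; apply/negP => /orP[].
  by case: p => // a; rewrite sedge_irr.
case/existsP => i /andP[/eqP {1}-> ].
by rewrite (negbTE (path_vertex_neqS neq_uv (ltn_ord i))).
Qed.

Definition add_path (G : sgraph) (u v : G) (k : nat) (neq_uv : u != v) : sgraph :=
  SGraph (@add_path_edge_sym G u v k) (@add_path_edge_irr G u v k neq_uv).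
Arguments add_path {G u v} k neq_uv.

(* Main.v *)
Require Import Defs.
From HB Require Import structures.
From mathcomp Require Import all_boot.
From mathcomp Require Import zify.

Set Implicit Arguments.
Unset Strict Implicit.
Unset Printing Implicit Defensive.

(** A dominating set D of G_{u,v,k} is pushed back to G by the map fixing the
    vertices of G, sending x_1 to u and every other new vertex to v.  The image
    can only fail to dominate v when k = 1, where x_1 is adjacent to both u and
    v; adding v costs one vertex and gives (a).  If k >= 5 then x_3 is dominated
    by some x_j with 2 <= j <= 4, which is adjacent to no vertex of G and so can
    be dropped from D before pushing back; this gives (b). *)

Lemma domination_number_le (G : sgraph) (D : {set G}) :
  dominating D -> domination_number G <= #|D|.
Proof.
rewrite /domination_number; case: arg_minnP => [|A _ minA]; last exact: minA.
by apply/forallP => x; rewrite in_setT.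
Qed.

Lemma domination_number_witness (G : sgraph) :
  exists2 D : {set G}, dominating D & #|D| = domination_number G.
Proof.
rewrite /domination_number; case: arg_minnP => [|A domA _]; last by exists A.
by apply/forallP => x; rewrite in_setT.
Qed.

Section AddPath.

Variables (G : sgraph) (u v : G) (k : nat).
Implicit Types (a b : G) (i j : 'I_k).

(** The bound on [n] matters: [path_vertex] takes the default value [v] at every index beyond
    [k]. *)
Lemma path_vertex_eq_inl n a : 0 < k -> n < k.+2 ->
  path_vertex u v k n = inl a -> (n == 0) && (a == u) || (n == k.+1) && (a == v).
Proof.
case: n => [|n] k_gt0 n_lt /=; first by case=> ->; rewrite eqxx.
case: insubP => //= n_ge [<-]; rewrite eqxx andbT; lia.
Qed.

Lemma path_vertex_eq_inr n i : path_vertex u v k n = inr i -> n = i.+1.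
Proof. by case: n => [|n] //=; case: insubP => //= j _ <- [->]. Qed.

(** Only the indices 0 and [k.+1] of the path land in [G], and for [k > 0] they are not consecutive,
    so the path creates no edge inside [G]. *)
Lemma add_path_edge_inl a b : 0 < k ->
  add_path_edge u v k (inl a) (inl b) = sedge a b.
Proof.
move=> k_gt0; rewrite /add_path_edge.
have no_edge c d : [exists m : 'I_k.+1, (inl c == path_vertex u v k m)
    && (inl d == path_vertex u v k m.+1)] = false.
  apply/existsP => -[m /andP[/eqP/esym cE /eqP/esym dE]].
  have m_lt := ltn_ord m.
  have := path_vertex_eq_inl k_gt0 (leqW m_lt) cE.
  have := path_vertex_eq_inl k_gt0 (m_lt : m.+1 < k.+2) dE.
  case/orP=> /andP[/eqP m1 _]; case/orP=> /andP[/eqP m2 _]; lia.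
by rewrite !no_edge !orbF.
Qed.

Lemma add_path_edge_inl_inr a i : 0 < k -> add_path_edge u v k (inl a) (inr i) ->
  (a == u) && (i == 0 :> nat) || (a == v) && (i.+1 == k).
Proof.
move=> k_gt0 /orP[] //.
case/orP=> /existsP[m /andP[/eqP/esym pE /eqP/esym qE]]; have m_lt := ltn_ord m.
- have := path_vertex_eq_inr qE.
  have /orP[/andP[/eqP-> ->]|/andP[/eqP m_eq _]] :=
    path_vertex_eq_inl k_gt0 (leqW m_lt) pE; first by move=> [<-].
  lia.
- have := path_vertex_eq_inr pE.
  have /orP[/andP[//]|/andP[/eqP m_eq ->]] :=
    path_vertex_eq_inl k_gt0 (m_lt : m.+1 < k.+2) qE.
  move=> i_eq; apply/orP; right; apply/eqP; lia.
Qed.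

Lemma add_path_edge_inr i j : add_path_edge u v k (inr i) (inr j) ->
  (j == i.+1 :> nat) || (i == j.+1 :> nat).
Proof.
case/orP=> //; case/orP=> /existsP[m /andP[/eqP/esym pE /eqP/esym qE]];
  have := path_vertex_eq_inr pE; have := path_vertex_eq_inr qE; lia.
Qed.

Hypothesis neq_uv : u != v.

(** A vertex of [G] dominated by a new vertex is [u] next to [x_1] or [v] next to [x_k]; the last
    two hypotheses put it in [A] itself. Leaving [A] abstract serves both (a) and (b). *)
Lemma dominating_restrict (D : {set add_path k neq_uv}) (A : {set G}) :
  0 < k -> dominating D ->
  (forall a, inl a \in D -> a \in A) ->
  (forall i, inr i \in D -> i = 0 :> nat -> u \in A) ->
  (forall i, inr i \in D -> i.+1 = k -> v \in A) ->
  dominating A.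
Proof.
move=> k_gt0 /forallP domD DA uA vA; apply/forallP => z.
have /orP[/DA->//|/existsP[[y|i] /andP[yD]]] := domD (inl z); rewrite /=.
  rewrite add_path_edge_inl // => zy.
  by apply/orP; right; apply/existsP; exists y; rewrite DA.
case/add_path_edge_inl_inr/orP=> // /andP[/eqP-> /eqP iE].
- by rewrite (uA i).
- by rewrite (vA i).
Qed.

Definition retract_path (p : G + 'I_k) : G :=
  match p with inl a => a | inr i => if i == 0 :> nat then u else v end.

End AddPath.

Theorem mainTheorem1 (G : sgraph) (u v : G) (neq_uv : u != v) :
  (forall k : nat, 1 <= k ->
     domination_number G - 1 <= domination_number (add_path k neq_uv)) /\
  (forall k : nat, 5 <= k ->
     domination_number (add_path k neq_uv) > domination_number G).
Proof.
split=> k k_ge; have [D domD <-] := domination_number_witness (add_path k neq_uv);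
  pose f : add_path k neq_uv -> G := @retract_path G u v k.
- have fD p : p \in D -> f p \in v |: f @: D.
    by move=> pD; rewrite setU1r ?imset_f.
  rewrite leq_subLR; apply: (@leq_trans #|v |: f @: D|).
    apply/domination_number_le/(dominating_restrict k_ge domD).
    + by move=> a /fD.
    + by move=> i /fD /= iA i0; rewrite i0 in iA.
    + by move=> *; rewrite setU11.
  by rewrite cardsU1 leq_add ?leq_b1 ?leq_imset_card.
- have k_gt0 : 0 < k by lia.
  have k_gt2 : 2 < k by lia.
  (* Since [inr j] is [x_(j+1)], this range means [x_2], [x_3], [x_4], the closed neighbourhood of
     [x_3]. *)
  have [j jD /andP[j_ge j_le]] : exists2 j : 'I_k, inr j \in D & 1 <= j <= 3.
    have /orP[x3D|/existsP[[a|j] /andP[yD]]] :=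
      forallP domD (inr (Ordinal k_gt2)); first by exists (Ordinal k_gt2).
    (* A neighbour of [x_3] in [G] would force [2 = 0] or [k = 3]. *)
    + rewrite sedge_sym => /add_path_edge_inl_inr -/(_ k_gt0).
      by case/orP=> /andP[_ /eqP /= E]; lia.
    + by move/add_path_edge_inr => /= E; exists j => //; lia.
  have fD p : p \in D -> p != inr j -> f p \in f @: (D :\ inr j).
    by move=> pD pj; apply: imset_f; rewrite !inE pj.
  (* Removing [inr j] supplies the strict inequality. *)
  rewrite (cardsD1 (inr j) D) jD ltnS.
  apply: leq_trans (leq_imset_card f _).
  apply/domination_number_le/(dominating_restrict k_gt0 domD).
  + by move=> a /fD; apply.
  (* [x_1] survives the removal because [j >= 1]. *)
  + move=> i /fD /= iA i0; rewrite i0 in iA; apply: iA.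
    by apply/eqP => -[ij]; move: j_ge; rewrite -ij i0.
  (* Here [i = k - 1 >= 4], so [x_k] is retracted to [v], not [u], and differs from the removed
     vertex. *)
  + move=> i /fD /= iA ik.
    have i0 : (i == 0 :> nat) = false by apply/eqP; lia.
    rewrite i0 in iA; apply: iA.
    by apply/eqP => -[ij]; move: j_le; rewrite -ij; lia.
Qed.
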